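(* Let $(g,h,\omega)$ be a Born structure on a smooth manifold $M$ with recursion operators $A,B,J$. Then $A$, $B$ and $J$ pairwise anti-commute and $ABJ=\mathrm{Id}$.
   Context: A Born structure on a smooth manifold $M$ is a triple $(g,h,\omega)$ where $g,h$ are pseudo-Riemannian metrics (of any signature) and $\omega$ is a non-degenerate 2-form such that the endomorphism fields $A,B,J$ of $TM$ (the recursion operators) determined by $g(AX,Y)=\omega(X,Y)$, $g(BX,Y)=h(X,Y)$, $\omega(-JX,Y)=h(X,Y)$ satisfy $A^2=B^2=-J^2=\mathrm{Id}$. *)

(* Defs.v *)
From HB Require Import structures.
From mathcomp Require Import all_boot all_order all_algebra.
From mathcomp Require Import all_classical all_reals topology normedtype derive.
Set Implicit Arguments.
Unset Strict Implicit.
Unset Printing Implicit Defensive.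
Import Order.TTheory GRing.Theory Num.Theory.
Import numFieldNormedType.Exports.
Local Open Scope classical_set_scope.
Local Open Scope ring_scope.

(* Used for open [U] only: [f] is total, and its partial derivatives at a point
   of [U] then depend only on the values of [f] on [U]. *)
Fixpoint Ck_on (R : realType) (n : nat) (W : normedModType R) (k : nat)
    (U : set 'rV[R]_n) (f : 'rV[R]_n -> W) : Prop :=
  {in U, continuous f} /\
  if k is k'.+1 then
    forall i : 'I_n,
      {in U, forall x, derivable f x 'e_i} /\ Ck_on k' U ('D_('e_i) f)
  else True.

Definition smooth_on (R : realType) (n : nat) (W : normedModType R)
    (U : set 'rV[R]_n) (f : 'rV[R]_n -> W) := forall k, Ck_on k U f.

Section SmoothOnTheory.
Context {R : realType} {n : nat}.
Implicit Types (U : set 'rV[R]_n) (f g : 'rV[R]_n -> R).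

Lemma Ck_on_ext k U f g :
  open U -> {in U, f =1 g} -> Ck_on k U f -> Ck_on k U g.
Proof.
move=> oU; elim: k f g => [|k IH] f g fg [cf Df].
all: have nfg x : x \in U -> {near x, f =1 g}
  by move=> /set_mem Ux; near=> y; apply/fg/mem_set; near: y;
     exact: open_nbhs_nbhs.
all: have cg : {in U, continuous g}
  by move=> x xU; rewrite /prop_for /continuous_at -(fg _ xU);
     apply: cvg_trans (cf x xU); exact: near_eq_cvg (nfg x xU).
  by split.
split=> // i; have [dfi Dfi] := Df i; split=> [x xU|].
  exact: near_eq_derivable (nfg x xU) (dfi x xU).
by apply: IH Dfi => x xU; apply: near_eq_derive; exact: nfg.
Unshelve. all: by end_near. Qed.

Lemma Ck_onS k U f : Ck_on k.+1 U f -> Ck_on k U f.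
Proof.
by elim: k f => [|k IH] f [cf Df]; split=> // i; have [? /IH] := Df i.
Qed.

Lemma Ck_on_cst k U (c : R) : open U -> Ck_on k U (cst c).
Proof.
move=> oU; elim: k c => [|k IH] c; split=> //.
- by move=> x _; exact: cst_continuous.
- by move=> x _; exact: cst_continuous.
- move=> i; split=> [x _|]; first exact: derivable_cst.
  by apply: Ck_on_ext (IH 0) => // x _; rewrite derive_cst.
Qed.

Lemma Ck_onD k U f g : open U -> Ck_on k U f -> Ck_on k U g -> Ck_on k U (f + g).
Proof.
move=> oU; elim: k f g => [|k IH] f g [cf Df] [cg Dg]; split=> //.
- by move=> x xU; apply: continuousD; [exact: cf|exact: cg].
- by move=> x xU; apply: continuousD; [exact: cf|exact: cg].
- move=> i; have [df Dfi] := Df i; have [dg Dgi] := Dg i.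
  split=> [x xU|]; first by apply: derivableD; [exact: df|exact: dg].
  apply: Ck_on_ext (IH _ _ Dfi Dgi) => // x xU.
  by rewrite deriveD //; [exact: df|exact: dg].
Qed.

Lemma Ck_onM k U f g : open U -> Ck_on k U f -> Ck_on k U g -> Ck_on k U (f * g).
Proof.
move=> oU; elim: k f g => [|k IH] f g sf sg; split=> //.
- by move=> x xU; apply: continuousM; [exact: sf.1|exact: sg.1].
- by move=> x xU; apply: continuousM; [exact: sf.1|exact: sg.1].
- move=> i; have [df Dfi] := sf.2 i; have [dg Dgi] := sg.2 i.
  split=> [x xU|]; first by apply: derivableM; [exact: df|exact: dg].
  have := Ck_onD oU (IH _ _ (Ck_onS sf) Dgi) (IH _ _ (Ck_onS sg) Dfi).
  apply: Ck_on_ext => // x xU.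
  by rewrite deriveM //; [exact: df|exact: dg].
Qed.

End SmoothOnTheory.

Record chart (R : realType) (n : nat) (M : topologicalType) := Chart {
  chart_dom : set M;
  chart_cod : set 'rV[R]_n;
  chart_fun : M -> 'rV[R]_n;
  chart_inv : 'rV[R]_n -> M;
  chart_dom_open : open chart_dom;
  chart_cod_open : open chart_cod;
  chart_funP : {homo chart_fun : x / chart_dom x >-> chart_cod x};
  chart_invP : {homo chart_inv : y / chart_cod y >-> chart_dom y};
  chart_funK : {in chart_dom, cancel chart_fun chart_inv};
  chart_invK : {in chart_cod, cancel chart_inv chart_fun};
  chart_fun_continuous : {in chart_dom, continuous chart_fun};
  chart_inv_continuous : {in chart_cod, continuous chart_inv}
}.

(* The atlas is not required to be maximal; everything below depends only on
   the smooth structure it generates. *)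
Record manifold (R : realType) (n : nat) := Manifold {
  manifold_sort :> topologicalType;
  manifold_hausdorff : hausdorff_space manifold_sort;
  manifold_second_countable : @second_countable manifold_sort;
  atlas : set (chart R n manifold_sort);
  atlas_cover : forall p : manifold_sort, exists2 c, atlas c & chart_dom c p;
  atlas_compatible : forall c1 c2, atlas c1 -> atlas c2 ->
    smooth_on (chart_cod c1 `&` chart_inv c1 @^-1` chart_dom c2)
              (chart_fun c2 \o chart_inv c1)
}.

Definition smooth_map (R : realType) (n : nat) (M : manifold R n) : pred (M -> R) :=
  fun f => `[< forall c, atlas c -> smooth_on (chart_cod c) (f \o chart_inv c) >].

(* C^oo(M) *)
Record smooth_fun (R : realType) (n : nat) (M : manifold R n) := SmoothFun {
  smooth_fun_val :> M -> R;
  smooth_funP : smooth_map smooth_fun_val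
}.

Section SmoothFunAlgebra.
Context {R : realType} {n : nat} {M : manifold R n}.

Lemma smooth_map_cst (a : R) : smooth_map (cst a : M -> R).
Proof. by apply/asboolP => c _ k; apply: Ck_on_cst; exact: chart_cod_open. Qed.

Lemma smooth_mapD (f g : M -> R) :
  smooth_map f -> smooth_map g -> smooth_map (f + g).
Proof.
move=> /asboolP sf /asboolP sg; apply/asboolP => c ac k.
by apply: Ck_onD; [exact: chart_cod_open|exact: sf|exact: sg].
Qed.

Lemma smooth_mapM (f g : M -> R) :
  smooth_map f -> smooth_map g -> smooth_map (f * g).
Proof.
move=> /asboolP sf /asboolP sg; apply/asboolP => c ac k.
by apply: Ck_onM; [exact: chart_cod_open|exact: sf|exact: sg].
Qed.

Lemma smooth_mapZ a (f : M -> R) : smooth_map f -> smooth_map (a *: f).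
Proof. exact: smooth_mapM (smooth_map_cst a). Qed.

Lemma smooth_map_subring_closed : subring_closed (@smooth_map R n M).
Proof.
split=> [|f g sf sg|f g]; [exact: smooth_map_cst| |exact: smooth_mapM].
by rewrite -scaleN1r; apply: smooth_mapD => //; exact: smooth_mapZ.
Qed.

Lemma smooth_map_submod_closed : subsemimod_closed (@smooth_map R n M).
Proof.
split; last exact: smooth_mapZ.
by split; [exact: smooth_map_cst|exact: smooth_mapD].
Qed.

HB.instance Definition _ := [isSub for @smooth_fun_val R n M].
HB.instance Definition _ := [Choice of smooth_fun M by <:].
HB.instance Definition _ := GRing.SubChoice_isSubPzRing.Build
  _ _ (smooth_fun M) smooth_map_subring_closed.
HB.instance Definition _ := GRing.SubZmodule_isSubLmodule.Build
  R _ _ (smooth_fun M) smooth_map_submod_closed.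

End SmoothFunAlgebra.

Definition derivation_at (R : realType) (n : nat) (M : manifold R n) (p : M) :
    pred (smooth_fun M -> R^o) :=
  fun D => `[< (forall a f g, D (a *: f + g) = a * D f + D g) /\
               (forall f g, D (f * g) = f p * D g + g p * D f) >].

(* T_p M, as the space of derivations of C^oo(M) at p *)
Record tangent (R : realType) (n : nat) (M : manifold R n) (p : M) := Tangent {
  tangent_val :> smooth_fun M -> R^o;
  tangentP : derivation_at p tangent_val
}.

Section TangentSpace.
Context {R : realType} {n : nat} {M : manifold R n} (p : M).

Lemma derivation_at_submod_closed : subsemimod_closed (@derivation_at R n M p).
Proof.
split=> [|a D /asboolP[DD DM]].
- split=> [|D E /asboolP[DD DM] /asboolP[ED EM]]; apply/asboolP; split=> *.
  + by rewrite {2 3}/GRing.zero /= mulr0 addr0.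
  + by rewrite {2 3}/GRing.zero /= !mulr0 addr0.
  + by rewrite {1}/GRing.add /= DD ED mulrDr addrACA.
  + by rewrite {1}/GRing.add /= DM EM !mulrDr addrACA.
- apply/asboolP; split=> *.
  + by rewrite {1}/GRing.scale /= DD scalerDr /GRing.scale /= mulrCA.
  + rewrite {1}/GRing.scale /= DM scalerDr /GRing.scale /=.
    by rewrite mulrCA [X in _ + X]mulrCA.
Qed.

HB.instance Definition _ := [isSub for @tangent_val R n M p].
HB.instance Definition _ := [Choice of tangent p by <:].
HB.instance Definition _ := GRing.SubChoice_isSubLmodule.Build
  R _ _ (tangent p) derivation_at_submod_closed.

End TangentSpace.

Definition smooth_vector_field (R : realType) (n : nat) (M : manifold R n)
    (X : forall p : M, tangent p) :=
  forall f : smooth_fun M, smooth_map (fun p => X p f).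

(* A (0,2)-tensor field; its smoothness is tested on global smooth vector
   fields, of which there are enough because M has bump functions. *)
Record tensor02 (R : realType) (n : nat) (M : manifold R n) := Tensor02 {
  tensor02_val :> forall p : M, {biscalar tangent p};
  tensor02_smooth : forall X Y : forall p : M, tangent p,
    smooth_vector_field X -> smooth_vector_field Y ->
    smooth_map (fun p => tensor02_val p (X p) (Y p))
}.

Record endo_field (R : realType) (n : nat) (M : manifold R n) := EndoField {
  endo_field_val :> forall p : M, {linear tangent p -> tangent p};
  endo_field_smooth : forall X : forall p : M, tangent p,
    smooth_vector_field X -> smooth_vector_field (fun p => endo_field_val p (X p))
}.

Section Born.
Context {R : realType} {n : nat} {M : manifold R n}.
Implicit Types (g h omega : tensor02 M) (A B J : endo_field M).

Definition nondegenerate_tensor (b : tensor02 M) :=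
  forall (p : M) (X : tangent p), (forall Y, b p X Y = 0) -> X = 0.

Definition pseudo_riemannian_metric g :=
  (forall (p : M) (X Y : tangent p), g p X Y = g p Y X) /\ nondegenerate_tensor g.

Definition two_form omega := forall (p : M) (X : tangent p), omega p X X = 0.

Definition recursion_operators g h omega A B J :=
  forall (p : M) (X Y : tangent p),
    [/\ g p (A p X) Y = omega p X Y,
        g p (B p X) Y = h p X Y
      & omega p (- J p X) Y = h p X Y].

Definition born_structure g h omega :=
  [/\ pseudo_riemannian_metric g,
      pseudo_riemannian_metric h,
      two_form omega /\ nondegenerate_tensor omega
    & exists A B J, recursion_operators g h omega A B J /\
        forall (p : M) (X : tangent p),
          [/\ A p (A p X) = X, B p (B p X) = X & - J p (J p X) = X]].

Definition anticommute A B :=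
  forall (p : M) (X : tangent p), A p (B p X) = - B p (A p X).

End Born.

(* Main.v *)
Require Import Defs.
From mathcomp Require Import all_boot all_order all_algebra.
From mathcomp Require Import all_classical all_reals topology normedtype derive.
Import GRing.Theory.
Local Open Scope ring_scope.

(** The statement is pointwise linear algebra on each tangent space.  Since
    omega = g(A _, _), the equation omega(-JX, Y) = h(X, Y) = g(BX, Y) reads
    g(A(-JX), Y) = g(BX, Y), so non-degeneracy of g gives A(-JX) = BX, and
    A^2 = Id turns this into J = -AB ([recursion_J]).  Then J^2 = -Id says
    (AB)^2 = -Id, which for two involutions A and B is the same as AB = -BA
    ([involutions_anticommute]); the remaining identities follow by substituting
    J = -AB.

    A Born structure only asserts that some recursion operators square to
    Id, Id and -Id.  The same non-degeneracy argument makes recursion operators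
    unique, so these identities pass to the given A, B and J
    ([born_recursion_squares]). *)

(** Applying A on the left and B on the right of ABAB = -Id cancels the outer
    involutions and leaves BA = -AB. *)
Lemma involutions_anticommute {V : zmodType} {A B : {additive V -> V}} :
  involutive A -> involutive B -> (forall x, A (B (A (B x))) = - x) ->
  forall x, A (B x) = - B (A x).
Proof.
move=> AK BK ABAB x.
by have := congr1 A (ABAB (B x)); rewrite AK BK raddfN => ->; rewrite opprK.
Qed.

Section RecursionOperators.
Context {R : realType} {n : nat} {M : manifold R n}.
Implicit Types (g h omega : tensor02 M) (A B J : endo_field M).

Lemma nondegenerate_inj {g} {p : M} (X Y : tangent p) :
  nondegenerate_tensor g -> (forall Z, g p X Z = g p Y Z) -> X = Y.
Proof.
move=> ndg eqXY; apply/subr0_eq/ndg => Z.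
by rewrite linearBl eqXY subrr.
Qed.

Lemma recursion_AJ {g h omega A B J} :
  nondegenerate_tensor g -> recursion_operators g h omega A B J ->
  forall (p : M) (X : tangent p), A p (- J p X) = B p X.
Proof.
move=> ndg rec p X; apply: (nondegenerate_inj _ _ ndg) => Y.
by have [-> _ _] := rec p (- J p X) Y; have [_ -> ->] := rec p X Y.
Qed.

Lemma recursion_J {g h omega A B J} :
  nondegenerate_tensor g -> recursion_operators g h omega A B J ->
  (forall p : M, involutive (A p)) ->
  forall (p : M) (X : tangent p), J p X = - A p (B p X).
Proof.
by move=> ndg rec AK p X; rewrite -(recursion_AJ ndg rec) AK opprK.
Qed.

Lemma recursion_A_unique {g h omega A B J A' B' J'} :
  nondegenerate_tensor g ->
  recursion_operators g h omega A B J ->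
  recursion_operators g h omega A' B' J' ->
  forall p : M, A p =1 A' p.
Proof.
move=> ndg rec rec' p X; apply: (nondegenerate_inj _ _ ndg) => Y.
by have [-> _ _] := rec p X Y; have [-> _ _] := rec' p X Y.
Qed.

Lemma recursion_B_unique {g h omega A B J A' B' J'} :
  nondegenerate_tensor g ->
  recursion_operators g h omega A B J ->
  recursion_operators g h omega A' B' J' ->
  forall p : M, B p =1 B' p.
Proof.
move=> ndg rec rec' p X; apply: (nondegenerate_inj _ _ ndg) => Y.
by have [_ -> _] := rec p X Y; have [_ -> _] := rec' p X Y.
Qed.

(** Any recursion operators of the Born structure coincide with those that it
    asserts to exist: A and B by non-degeneracy of g, and then J because it
    equals -AB for both. *)
Lemma born_recursion_squares {g h omega A B J} :
  born_structure g h omega -> recursion_operators g h omega A B J ->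
  [/\ forall p : M, involutive (A p), forall p : M, involutive (B p)
    & forall (p : M) (X : tangent p), J p (J p X) = - X].
Proof.
move=> [[_ ndg] _ _ [A' [B' [J' [rec' sq']]]]] rec.
have eqA := recursion_A_unique ndg rec rec'.
have eqB := recursion_B_unique ndg rec rec'.
have AK' p : involutive (A' p) by move=> X; have [] := sq' p X.
have AK p : involutive (A p) by move=> X; rewrite !eqA AK'.
have eqJ p : J p =1 J' p.
  by move=> X; rewrite (recursion_J ndg rec) // (recursion_J ndg rec') // eqA eqB.
split=> // p X; have [_ BB' JJ'] := sq' p X; first by rewrite !eqB.
by rewrite !eqJ -{2}JJ' opprK.
Qed.

End RecursionOperators.

Theorem lemma7 (R : realType) (n : nat) (M : manifold R n)
  (g h omega : tensor02 M) (A B J : endo_field M)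
  (hborn : born_structure g h omega)
  (hrec : recursion_operators g h omega A B J) :
  [/\ anticommute A B, anticommute A J, anticommute B J
    & forall (p : M) (X : tangent p), A p (B p (J p X)) = X].
Proof.
have [[_ ndg] _ _ _] := hborn.
have [AK BK JJ] := born_recursion_squares hborn hrec.
have J_AB := recursion_J ndg hrec AK.
have ABAB p (X : tangent p) : A p (B p (A p (B p X))) = - X.
  by rewrite -JJ !J_AB !linearN opprK.
have AB : anticommute A B.
  by move=> p; exact: involutions_anticommute (AK p) (BK p) (ABAB p).
split=> // p X.
- by rewrite !J_AB linearN AK AB AK opprK.
- by rewrite !J_AB linearN -AB BK opprK.
- by rewrite J_AB !linearN ABAB opprK.
Qed.
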